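(* Suppose there exist non-negative functions $\psi_{j,k}:\mathcal X\times\{1,\dots,n\}\to\mathbb R$, $j=1,\dots,p_k$, $k=1,\dots,r$ (with $\sum_{k=1}^r p_k=p$), and constants $\{c_{i,\theta}\}$ such that for all $\theta,\tilde\theta\in\Theta_*$ and all $i=1,\dots,n$, $$\bigl|[\rho_\theta(X_i)-c_{i,\theta}]-[\rho_{\tilde\theta}(X_i)-c_{i,\tilde\theta}]\bigr|\le\sum_{k=1}^r\Bigl|\sum_{j=1}^{p_k}(\theta_{j,k}-\tilde\theta_{j,k})\,\psi_{j,k}(X_i,i)\Bigr| .$$ Let $K_n:=\max_{j,k}\|\psi_{j,k}\|_n$. Then, for a universal constant $C$ (not depending on any other quantity), $$\mathbb E\Bigl(\sup_{\theta\in\Theta_M(\theta^* )}|Y^\varepsilon(\theta,\theta^* )|\,\Big|\,\mathbf X\Bigr)\le C\,2^{r-1}\,M\,\sqrt{\frac{2\log(2p)}{n}}\;K_n .$$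
   Context: $X_1,\dots,X_n$ are independent random variables with values in a measurable space $\mathcal X$, and $\mathbf X:=(X_1,\dots,X_n)$. $\Theta\subset\mathbb R^p$ is a parameter space, and $\Theta_*$ is either $\Theta$ itself or the smallest convex set containing $\Theta$. For each $\theta\in\Theta_*$ a loss function $\rho_\theta:\mathcal X\to\mathbb R$ is given. Vectors in $\mathbb R^p$ are indexed as $\theta=(\theta_{j,k}:\ j=1,\dots,p_k,\ k=1,\dots,r)$, with $\sum_{k=1}^r p_k=p$, and $\|\theta\|_1$ is the $\ell_1$-norm. The $c_{i,\theta}$ ($i=1,\dots,n$, $\theta\in\Theta_*$) are non-random real constants, and $\rho^c_\theta(X_i,i):=\rho_\theta(X_i)-c_{i,\theta}$. $\theta^*\in\Theta$ is fixed, and for $M>0$, $$\Theta_M(\theta^* ):=\{\theta\in\Theta_*:\ \|\theta-\theta^*\|_1\le M\}.$$ For $g:\mathcal X\times\{1,\dots,n\}\to\mathbb R$, $\|g\|_n^2:=\frac1n\sum_{i=1}^n g^2(X_i,i)$. $\varepsilon_1,\dots,\varepsilon_n$ is a Rademacher sequence (i.i.d., values $\pm1$ with probability $1/2$ each) independent of $\mathbf X$, and the symmetrized process is $$Y^\varepsilon(\theta,\theta^* ):=\frac1n\sum_{i=1}^n\varepsilon_i\bigl[\rho^c_\theta(X_i,i)-\rho^c_{\theta^*}(X_i,i)\bigr].$$ *)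

(* Defs.v *)
From HB Require Import structures.
From mathcomp Require Export all_boot all_order all_algebra.
From mathcomp Require Export all_classical all_reals all_analysis.
From mathcomp Require Export measurable_realfun.

Set Implicit Arguments.
Unset Strict Implicit.
Unset Printing Implicit Defensive.

Import Order.TTheory GRing.Theory Num.Theory.
Import numFieldNormedType.Exports.

Local Open Scope classical_set_scope.
Local Open Scope ring_scope.

Definition mutually_independent d d' (W : measurableType d)
    (T : measurableType d') (R : realType) (P : probability W R)
    (I : finType) (X : I -> W -> T) : Prop :=
  forall (J : {set I}) (A : I -> set T),
    (forall i, i \in J -> measurable (A i)) ->
    P (\bigcap_(i in [set i | i \in J]) (X i @^-1` A i)) =
    (\prod_(i in J) P (X i @^-1` A i))%E.

Definition independent_classes d (W : measurableType d) (R : realType)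
    (P : probability W R) (F G : set (set W)) : Prop :=
  forall A B, F A -> G B -> P (A `&` B) = (P A * P B)%E.

Definition rademacher_sequence d (W : measurableType d) (R : realType)
    (P : probability W R) (n : nat) (eps : 'I_n -> {RV P >-> R}) : Prop :=
  [/\ mutually_independent P (fun i => eps i : W -> R),
      (forall i, P (eps i @^-1` [set 1]) = (2^-1)%:E) &
      (forall i, P (eps i @^-1` [set -1]) = (2^-1)%:E)].

(* [Z] is a version of E(Y | F), for a [0, +oo]-valued random variable [Y] (not
   necessarily integrable) and a sub-sigma-algebra [F]; it is unique up to
   P-almost sure equality. *)
Definition is_cond_expectation d (W : measurableType d) (R : realType)
    (P : probability W R) (F : set (set W)) (Y Z : W -> \bar R) : Prop :=
  [/\ measurable_fun setT Y /\ (forall w, (0 <= Y w)%E),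
      (forall w, (0 <= Z w)%E),
      (forall B : set (\bar R), measurable B -> F (Z @^-1` B)) &
      (forall A, F A -> (\int[P]_(w in A) Z w = \int[P]_(w in A) Y w)%E)].

(* A chosen version. The default value [+oo] makes an upper bound on
   [cond_expectation P F Y] entail that E(Y | F) exists. *)
Definition cond_expectation d (W : measurableType d) (R : realType)
    (P : probability W R) (F : set (set W)) (Y : W -> \bar R) : W -> \bar R :=
  xget (cst +oo%E) [set Z | is_cond_expectation P F Y Z].

(* A vector of R^p, p = p_1 + ... + p_r, is a row vector of size
   [\sum_(k < r) p_ k]; its k-th group of coordinates is [submxrow theta k]. *)
Definition group_coord (R : realType) (r : nat) (p_ : 'I_r -> nat)
    (theta : 'rV[R]_(\sum_(k < r) p_ k)) (k : 'I_r) (j : 'I_(p_ k)) : R :=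
  submxrow theta k ord0 j.

(* The norm [`|theta|] of the library on row vectors is the sup norm. *)
Definition l1norm (R : realType) (p : nat) (theta : 'rV[R]_p) : R :=
  \sum_(i < p) `|theta ord0 i|.

Definition convex_hull (R : realType) (p : nat) (A : set 'rV[R]_p) :
    set 'rV[R]_p :=
  smallest (@convex_set R 'rV[R]_p) A.

Definition l1_ball (R : realType) (p : nat) (Thetas : set 'rV[R]_p)
    (theta0 : 'rV[R]_p) (M : R) : set 'rV[R]_p :=
  [set theta | Thetas theta /\ l1norm (theta - theta0) <= M].

Definition empirical_norm (R : realType) (T : Type) (n : nat)
    (x : 'I_n -> T) (g : T -> 'I_n -> R) : R :=
  Num.sqrt (n%:R^-1 * \sum_(i < n) g (x i) i ^+ 2).

Definition max_empirical_norm (R : realType) (T : Type) (n r : nat)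
    (p_ : 'I_r -> nat) (psi : forall k : 'I_r, 'I_(p_ k) -> T -> 'I_n -> R)
    (x : 'I_n -> T) : R :=
  \big[Num.max/0]_(k < r) \big[Num.max/0]_(j < p_ k)
    empirical_norm x (@psi k j).

Definition centered_loss (R : realType) (T : Type) (n p : nat)
    (rho : 'rV[R]_p -> T -> R) (c : 'I_n -> 'rV[R]_p -> R)
    (theta : 'rV[R]_p) (x : T) (i : 'I_n) : R :=
  rho theta x - c i theta.

Definition symmetrized_process (R : realType) (T : Type) (n p : nat)
    (rho : 'rV[R]_p -> T -> R) (c : 'I_n -> 'rV[R]_p -> R)
    (x : 'I_n -> T) (e : 'I_n -> R) (theta theta0 : 'rV[R]_p) : R :=
  n%:R^-1 * \sum_(i < n)
    e i * (centered_loss rho c theta (x i) i - centered_loss rho c theta0 (x i) i).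

(* Main.v *)
(** Conditionally on [X = x] the process is a Rademacher average over the sign
    vectors [e], and a sum over [e] of suprema over [theta] is bounded by [B] as
    soon as all sums [\sum_e h e (t e)] over selections [t] are. For selections,
    the coordinates [i] are treated one at a time: pairing [e] with the vector
    flipped at [i], the increment of the loss is at most
    [\sum_k |u_k - u'_k|], the mean over [k] of [r |u_k - u'_k|], so one may
    replace the loss at coordinate [i] by [r] times the linear form [u_k], for
    some [k] depending on [i]. The resulting linear process is at most [r M]
    times a maximum of [p] Rademacher sums, which is controlled by the
    exponential moment method, and [r <= 2 ^ (r - 1)].

    The suprema are measurable, as they may be restricted to a countable dense
    set of parameters. Since [X] is independent of the signs, the average over
    [e] is a version of the conditional expectation, and versions are almost
    surely unique. *)
Require Import Defs.
From mathcomp Require Import ring lra.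

Set Implicit Arguments.
Unset Strict Implicit.
Unset Printing Implicit Defensive.

Import Order.TTheory GRing.Theory Num.Theory.
Import numFieldNormedType.Exports.

Local Open Scope classical_set_scope.
Local Open Scope ring_scope.

Local Notation signs n := {ffun 'I_n -> bool}.

(** * Exponential moments and a maximal inequality for Rademacher sums *)

(** A weak form of cosh x <= exp (x^2 / 2). For x^2 <= 1/2, the bounds 1 / (1 - x) and 1 / (1 + x)
    on the two exponentials add up to 2 / (1 - x^2) <= 2 (1 + 2 x^2); beyond, |x| <= 2 x^2. *)
Lemma expR_sumN_le (R : realType) (x : R) :
  expR x + expR (- x) <= 2 * expR (2 * x ^+ 2).
Proof.
have e2 : 1 + 2 * x ^+ 2 <= expR (2 * x ^+ 2) by exact: expR_ge1Dx.
have [x2|x2] := leP (x ^+ 2) 2^-1.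
  have x1 : 0 < 1 - x by nra.
  have x1' : 0 < 1 + x by nra.
  have ex : expR x <= (1 - x)^-1.
    rewrite -[x in expR x]opprK expRN lef_pV2 ?posrE ?expR_gt0//.
    by have := expR_ge1Dx (- x).
  have eNx : expR (- x) <= (1 + x)^-1.
    by rewrite expRN lef_pV2 ?posrE ?expR_gt0// expR_ge1Dx.
  apply: (le_trans (lerD ex eNx)).
  have -> : (1 - x)^-1 + (1 + x)^-1 = 2 / (1 - x ^+ 2).
    field; rewrite !gt_eqF//; nra.
  apply: (@le_trans _ _ (2 * (1 + 2 * x ^+ 2))); last by rewrite ler_pM2l.
  rewrite ler_pM2l// -[leLHS]mul1r ler_pdivrMr; nra.
have ex : expR x <= expR (2 * x ^+ 2) by rewrite ler_expR; nra.
have eNx : expR (- x) <= expR (2 * x ^+ 2) by rewrite ler_expR; nra.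
lra.
Qed.

(** Distributivity turns the sum over sign vectors into a product over coordinates, bounded one
    factor at a time. *)
Lemma rademacher_mgf (R : realType) (n : nat) (a : 'I_n -> R) :
  \sum_(e : signs n) expR (\sum_i (-1) ^+ e i * a i) <=
  2 ^+ n * expR (2 * \sum_i a i ^+ 2).
Proof.
under eq_bigr do rewrite expR_sum.
rewrite -(bigA_distr_bigA (fun i (b : bool) => expR ((-1) ^+ b * a i))) /=.
rewrite mulr_sumr expR_sum -[n in 2 ^+ n]card_ord -prodr_const -big_split /=.
apply: ler_prod => i _; rewrite big_bool /= expr1 expr0 mul1r mulN1r.
by rewrite addr_ge0 ?expR_ge0//= addrC expR_sumN_le.
Qed.

(* Jensen's inequality is replaced by [1 + y <= expR y] with
   [y = l * |S| - ln (2 * #|Q|) - 2 * l ^+ 2 * sigma ^+ 2], where [S] is the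
   selected sum. *)
Lemma rademacher_maximal (R : realType) (n : nat) (Q : finType)
    (a : Q -> 'I_n -> R) (sigma : R) (q : signs n -> Q) :
  0 <= sigma -> (forall k, \sum_i a k i ^+ 2 <= sigma ^+ 2) ->
  \sum_(e : signs n) `|\sum_i (-1) ^+ e i * a (q e) i| <=
  2 ^+ n * (2 * sigma * Num.sqrt (2 * ln (2 * #|Q|%:R))).
Proof.
rewrite le_eqVlt => /predU1P[<- a0|sigma0 asigma].
  rewrite mulr0 mul0r mulr0 big1// => e _; rewrite big1 ?normr0// => i _.
  have : \sum_i a (q e) i ^+ 2 == 0.
    rewrite eq_le sumr_ge0 ?andbT ?(le_trans (a0 _)) ?expr0n//= => ? _.
    exact: sqr_ge0.
  rewrite psumr_eq0; last by move=> ? _; exact: sqr_ge0.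
  move=> /allP/(_ i); rewrite mem_index_enum sqrf_eq0 => /(_ isT)/eqP ->.
  by rewrite mulr0.
have Q0 : 1 <= #|Q|%:R :> R.
  by rewrite ler1n; apply/card_gt0P; exists (q [ffun=> true]).
set L := ln _; set s := Num.sqrt _.
have L0 : 0 < L by apply: ln_gt0; lra.
have s0 : 0 < s by rewrite sqrtr_gt0; lra.
have s2 : s ^+ 2 = 2 * L by rewrite sqr_sqrtr//; lra.
have eL : expR L = 2 * #|Q|%:R by rewrite lnK// posrE; lra.
(* This [l] minimises (L + 2 l^2 sigma^2) / l, the bound obtained on the mean of the selected
   absolute sum; at the minimum both summands equal [L]. *)
pose l := s / (2 * sigma).
have l0 : 0 < l by rewrite divr_gt0// mulr_gt0.
have lE : l * (2 * sigma) = s by rewrite divfK// gt_eqF// mulr_gt0.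
have l2E : 2 * l ^+ 2 * sigma ^+ 2 = L.
  apply: (@mulfI _ 2) => //.
  by rewrite -s2 -lE; ring.
pose S k (e : signs n) := \sum_i (-1) ^+ e i * a k i.
have mgf k (m : R) : m ^+ 2 = l ^+ 2 ->
    \sum_(e : signs n) expR (m * S k e) <= 2 ^+ n * expR L.
  move=> ml.
  apply: le_trans (_ : 2 ^+ n * expR (2 * \sum_i (m * a k i) ^+ 2) <= _).
    apply: le_trans (rademacher_mgf _); apply: ler_sum => e _.
    by rewrite ler_expR mulr_sumr; apply: ler_sum => i _; rewrite mulrCA.
  rewrite ler_pM2l ?exprn_gt0// ler_expR -l2E -mulrA ler_pM2l//.
  under eq_bigr do rewrite exprMn.
  by rewrite -mulr_sumr ml ler_wpM2l// sqr_ge0.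
(* Bounding the exponential at the selected index by the sum over all indices and both signs removes
   the dependence on [q]. *)
have step (e : signs n) : 1 + (l * `|S (q e) e| - L - L) <=
    (\sum_k (expR (l * S k e) + expR (- l * S k e))) * expR (- L) * expR (- L).
  apply: (le_trans (expR_ge1Dx _)); rewrite !expRD !ler_wpM2r ?expR_ge0//.
  rewrite (bigD1 (q e))//= -[leLHS]addr0 lerD//; last first.
    by rewrite sumr_ge0// => k _; rewrite addr_ge0 ?expR_ge0.
  case: (ger0P (S (q e) e)) => _; first by rewrite lerDl expR_ge0.
  by rewrite mulrN -mulNr lerDr expR_ge0.
have := @ler_sum _ _ (index_enum (signs n)) xpredT _ _ (fun e _ => step e).
rewrite -!mulr_suml exchange_big /=.
under [X in _ <= X * _ * _ -> _]eq_bigr do rewrite big_split /=.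
have -> : \sum_(e : signs n) (1 + (l * `|S (q e) e| - L - L)) =
    l * (\sum_(e : signs n) `|S (q e) e|) + 2 ^+ n * (1 - L - L).
  rewrite mulr_sumr -[2 ^+ n * _]mulrC -[n in 2 ^+ n]card_ord -natrX.
  rewrite -[in X in X%:R]card_bool -card_ffun mulr_natr -sumr_const.
  by rewrite -big_split /=; apply: eq_bigr => e _; ring.
have : \sum_k (\sum_(e : signs n) expR (l * S k e) +
       \sum_(e : signs n) expR (- l * S k e)) <=
     #|Q|%:R * (2 * (2 ^+ n * expR L)).
  rewrite mulr_natl -sumr_const; apply: ler_sum => k _.
  by rewrite mulr_natl mulr2n lerD// mgf// sqrrN.
set X := \sum_(k in Q) _; set Z := \sum_(e : signs n) _ => XQ ZX.
(* One factor [expR L = 2 * #|Q|%:R] pays for the number of exponential moments in [X], the other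
   for their size. *)
have : X * expR (- L) * expR (- L) <= 2 ^+ n.
  rewrite -mulrA -expRD -opprD expRN ler_pdivrMr ?expR_gt0// expRD eL.
  by rewrite (le_trans XQ)// eL; lra.
move=> XL.
rewrite -(ler_pM2l l0).
have -> : l * (2 ^+ n * (2 * sigma * s)) = 2 ^+ n * (l * (2 * sigma)) * s.
  by ring.
rewrite lE -mulrA -expr2 s2.
lra.
Qed.

(** * Contraction to linear forms *)

(* The sum [\sum_k `|u k a - u k b|] is the mean over [k] of the increments of
   [r * u k]; over a pair [e], [flip e] each of these increments is realised by
   a selection, up to exchanging the two selected points. *)
Lemma contraction_step (R : realType) (V : Type) (S : set V) (n r : nat)
    (i0 : 'I_n) (g : V -> 'I_n -> R) (u : 'I_r -> V -> R) (B : R) :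
  (0 < r)%N ->
  (forall a b, S a -> S b -> `|g a i0 - g b i0| <= \sum_k `|u k a - u k b|) ->
  (forall k (t : signs n -> V), (forall e, S (t e)) ->
     \sum_(e : signs n) \sum_i
       (-1) ^+ e i * (if i == i0 then r%:R * u k (t e) else g (t e) i) <= B) ->
  forall t : signs n -> V, (forall e, S (t e)) ->
    \sum_(e : signs n) \sum_i (-1) ^+ e i * g (t e) i <= B.
Proof.
move=> r0 gu Bk t St.
pose flip (e : signs n) : signs n :=
  [ffun i => if i == i0 then ~~ e i else e i].
have flipK : involutive flip.
  move=> e; apply/ffunP => i; rewrite !ffunE.
  by case: eqP => // _; rewrite negbK.
have flip0 (e : signs n) : (-1) ^+ flip e i0 = - (-1) ^+ e i0 :> R.
  by rewrite ffunE eqxx; case: (e i0); rewrite !(expr0, expr1) ?opprK.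
have flipN (e : signs n) i : i != i0 -> (-1) ^+ flip e i = (-1) ^+ e i :> R.
  by move=> ii0; rewrite ffunE (negbTE ii0).
have sum2 (H : signs n -> R) : 2 * (\sum_e H e) = \sum_e (H e + H (flip e)).
  rewrite big_split /= mulr_natl mulr2n; congr (_ + _).
  by rewrite (reindex_inj (inv_inj flipK)).
pose d k e := u k (t e) - u k (t (flip e)).
(* The test is invariant under [flip] (see [dflip]), so [tk] exchanges the two points of a pair
   together or not at all, and the increment of [u k] over the pair comes out as its absolute
   value. *)
pose tk k (e : signs n) :=
  if 0 <= (-1) ^+ e i0 * d k e then t e else t (flip e).
have Stk k e : S (tk k e) by rewrite /tk; case: ifP.
pose rest (e : signs n) :=
  \sum_(i | i != i0) (-1) ^+ e i * (g (t e) i + g (t (flip e)) i).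
have dflip k (e : signs n) :
    (-1) ^+ flip e i0 * d k (flip e) = (-1) ^+ e i0 * d k e.
  by rewrite flip0 /d flipK; ring.
have pairk k (e : signs n) :
    \sum_i (-1) ^+ e i *
      (if i == i0 then r%:R * u k (tk k e) else g (tk k e) i) +
    \sum_i (-1) ^+ flip e i *
      (if i == i0 then r%:R * u k (tk k (flip e)) else g (tk k (flip e)) i) =
    rest e + r%:R * `|d k e|.
  rewrite (bigD1 i0)//= [X in _ + X](bigD1 i0)//= eqxx addrACA.
  rewrite -big_split /= addrC.
  congr (_ + _).
    apply: eq_bigr => i ii0; rewrite (negbTE ii0) flipN// -mulrDr /tk dflip.
    by case: ifP => _; rewrite ?flipK// addrC.
  have nd : `|d k e| = `|(-1) ^+ e i0 * d k e|.
    by rewrite normrM normrX normrN1 expr1n mul1r.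
  rewrite nd flip0 /tk dflip flipK; case: ifPn => [s0|].
    by rewrite ger0_norm// /d; ring.
  by rewrite -ltNge => s0; rewrite ltr0_norm// /d; ring.
have pair (e : signs n) :
    \sum_i (-1) ^+ e i * g (t e) i +
    \sum_i (-1) ^+ flip e i * g (t (flip e)) i <=
    rest e + \sum_k `|d k e|.
  rewrite (bigD1 i0)//= [X in _ + X](bigD1 i0)//= addrACA -big_split /= addrC.
  apply: lerD.
    by under eq_bigr => i ii0 do rewrite flipN// -mulrDr.
  rewrite flip0 mulNr -mulrBr; apply: (le_trans (ler_norm _)).
  by rewrite normrM normrX normrN1 expr1n mul1r gu.
have r0' : 0 < r%:R :> R by rewrite ltr0n.
have rB : \sum_k \sum_e (rest e + r%:R * `|d k e|) <= r%:R * (2 * B).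
  rewrite -[r in r%:R * (2 * B)]card_ord mulr_natl -sumr_const.
  apply: ler_sum => k _; under eq_bigr do rewrite -pairk.
  by rewrite -sum2 ler_pM2l// Bk.
(* Scaling by 2 forms the pairs of [e] and [flip e]; scaling by [r] gives each of the [r] linear
   increments its own copy of [rest e], as in [rB]. *)
rewrite -(@ler_pM2l _ 2)// -(ler_pM2l r0'); apply: le_trans rB.
rewrite [leRHS]exchange_big /=.
rewrite sum2 mulr_sumr; apply: ler_sum => e _.
rewrite big_split /= sumr_const card_ord -[rest e *+ r]mulr_natl.
by rewrite -mulr_sumr -mulrDr ler_pM2l.
Qed.

(** Induction on the number [m] of coordinates that carry the loss [f]: with none, the hypothesis on
    linear forms applies; with all [n], the claim is reached. The bound is proved for every [kappa],
    since each step alters [kappa] at one coordinate. *)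
Lemma contraction (R : realType) (V : Type) (S : set V) (n r : nat)
    (f : V -> 'I_n -> R) (u : 'I_r -> V -> 'I_n -> R) (B : R) :
  (0 < r)%N ->
  (forall a b i, S a -> S b ->
     `|f a i - f b i| <= \sum_k `|u k a i - u k b i|) ->
  (forall (kappa : 'I_n -> 'I_r) (t : signs n -> V), (forall e, S (t e)) ->
     \sum_(e : signs n)
       \sum_i (-1) ^+ e i * (r%:R * u (kappa i) (t e) i) <= B) ->
  forall t : signs n -> V, (forall e, S (t e)) ->
    \sum_(e : signs n) \sum_i (-1) ^+ e i * f (t e) i <= B.
Proof.
move=> r0 fu Bu.
pose mix m (kappa : 'I_n -> 'I_r) v (i : 'I_n) :=
  if (i < m)%N then f v i else r%:R * u (kappa i) v i.
suff mixB m : (m <= n)%N -> forall kappa (t : signs n -> V),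
    (forall e, S (t e)) ->
    \sum_(e : signs n) \sum_i (-1) ^+ e i * mix m kappa (t e) i <= B.
  move=> t St; have := mixB n (leqnn n) (fun=> Ordinal r0) t St.
  by under eq_bigr do under eq_bigr do rewrite /mix ltn_ord.
elim: m => [_ kappa t St|m IH mn kappa]; first exact: Bu.
pose i0 := Ordinal mn.
apply: (@contraction_step _ _ S _ _ i0 _ (fun k v => u k v i0)) => //.
  by move=> a b Sa Sb; rewrite /mix ltnSn; exact: fu.
move=> k t St.
pose kappa' i := if i == i0 then k else kappa i.
have := IH (ltnW mn) kappa' t St; congr (_ <= _).
apply: eq_bigr => e _; apply: eq_bigr => i _; congr (_ * _).
rewrite /mix /kappa'; case: eqVneq => [->|ii0]; first by rewrite ltnn.
by rewrite ltnS [(i <= m)%N]leq_eqVlt -[_ == m]/(i == i0) (negbTE ii0).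
Qed.

(** * Grouped coordinates and the linear process *)

Lemma sum_group (R : nmodType) (r : nat) (p_ : 'I_r -> nat)
    (F : forall k, 'I_(p_ k) -> R) :
  \sum_k \sum_j F k j =
  \sum_(s < \sum_k p_ k) F (tagnat.sig1 s) (tagnat.sig2 s).
Proof. by rewrite sig_big_dep (reindex _ tagnat.sig_bij_on). Qed.

Lemma l1normE (R : realType) (r : nat) (p_ : 'I_r -> nat)
    (theta : 'rV[R]_(\sum_(k < r) p_ k)) :
  l1norm theta = \sum_k \sum_j `|group_coord theta (k := k) j|.
Proof.
rewrite sum_group; apply: eq_bigr => s _.
by rewrite /group_coord mxE tagnat.sig2K.
Qed.

Lemma group_coordB (R : realType) (r : nat) (p_ : 'I_r -> nat)
    (theta theta' : 'rV[R]_(\sum_(k < r) p_ k)) (k : 'I_r) (j : 'I_(p_ k)) :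
  group_coord (theta - theta') j = group_coord theta j - group_coord theta' j.
Proof. by rewrite /group_coord !mxE. Qed.

Lemma max_empirical_norm_ge0 (R : realType) (T : Type) (n r : nat)
    (p_ : 'I_r -> nat) (psi : forall k : 'I_r, 'I_(p_ k) -> T -> 'I_n -> R)
    (x : 'I_n -> T) : 0 <= max_empirical_norm psi x.
Proof. by apply: bigmax_ge_id. Qed.

(** The left side is [n] times a squared empirical norm; this supplies sigma = sqrt n K_n for the
    maximal inequality. *)
Lemma sum_sqr_max_empirical_norm (R : realType) (T : Type) (n r : nat)
    (p_ : 'I_r -> nat) (psi : forall k : 'I_r, 'I_(p_ k) -> T -> 'I_n -> R)
    (x : 'I_n -> T) (k : 'I_r) (j : 'I_(p_ k)) : (0 < n)%N ->
  \sum_i psi k j (x i) i ^+ 2 <=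
  (Num.sqrt n%:R * max_empirical_norm psi x) ^+ 2.
Proof.
move=> n0; have n0' : 0 < n%:R :> R by rewrite ltr0n.
have s0 : 0 <= \sum_i psi k j (x i) i ^+ 2.
  by apply: sumr_ge0 => i _; exact: sqr_ge0.
rewrite exprMn sqr_sqrtr ?ler0n// mulrC -ler_pdivrMr// mulrC.
rewrite -[leLHS]sqr_sqrtr ?mulr_ge0 ?invr_ge0 ?ler0n//.
rewrite lerXn2r ?nnegrE ?sqrtr_ge0 ?max_empirical_norm_ge0//.
apply: le_trans (le_bigmax _ _ k).
exact: (le_bigmax _ (fun j => empirical_norm x (psi k j)) j).
Qed.

(* By duality of the l1 and sup norms the sum over [i] is at most [M] times a
   maximum over the coordinates [s] of the sums [A e s]. *)
Lemma rademacher_dictionary (R : realType) (T : Type) (n r : nat)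
    (p_ : 'I_r -> nat) (psi : forall k : 'I_r, 'I_(p_ k) -> T -> 'I_n -> R)
    (x : 'I_n -> T) (M : R) (kappa : 'I_n -> 'I_r)
    (t : signs n -> 'rV[R]_(\sum_(k < r) p_ k)) :
  (0 < n)%N -> (0 < \sum_(k < r) p_ k)%N -> 0 <= M ->
  (forall e, l1norm (t e) <= M) ->
  \sum_(e : signs n) \sum_i (-1) ^+ e i *
    (\sum_j group_coord (t e) (k := kappa i) j * psi (kappa i) j (x i) i) <=
  2 ^+ n * (2 * M * (Num.sqrt n%:R * max_empirical_norm psi x) *
    Num.sqrt (2 * ln (2 * (\sum_(k < r) p_ k)%:R))).
Proof.
set p := (\sum_(k < r) p_ k)%N => n0 p0 M0 tM.
(* The entry [s] is extended by zero to the coordinates [i] whose selected group [kappa i] does not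
   contain it, so that one family of [p] entries serves all coordinates. *)
pose a (s : 'I_p) i := if tagnat.sig1 s == kappa i
  then psi (tagnat.sig1 s) (tagnat.sig2 s) (x i) i else 0.
pose A (e : signs n) s := `|\sum_i (-1) ^+ e i * a s i|.
pose q (e : signs n) := [arg max_(s > Ordinal p0) A e s]%O.
have qA e s : A e s <= A e (q e).
  by rewrite /q; case: arg_maxP => // s' _; exact.
have asigma s :
    \sum_i a s i ^+ 2 <= (Num.sqrt n%:R * max_empirical_norm psi x) ^+ 2.
  apply: le_trans (sum_sqr_max_empirical_norm psi x (tagnat.sig2 s) n0).
  apply: ler_sum => i _; rewrite /a; case: ifP => // _.
  by rewrite expr0n sqr_ge0.
have sigma0 : 0 <= Num.sqrt n%:R * max_empirical_norm psi x.
  by rewrite mulr_ge0 ?sqrtr_ge0 ?max_empirical_norm_ge0.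
have := rademacher_maximal q sigma0 asigma; rewrite card_ord.
move=> /(ler_wpM2l M0); rewrite mulr_sumr => qM.
apply: (le_trans (le_trans _ qM)); last first.
  by lra.
apply: ler_sum => e _.
have -> : \sum_i (-1) ^+ e i *
      (\sum_j group_coord (t e) (k := kappa i) j * psi (kappa i) j (x i) i) =
    \sum_(s < p) t e ord0 s * (\sum_i (-1) ^+ e i * a s i).
  under [RHS]eq_bigr do rewrite mulr_sumr.
  rewrite exchange_big /=; apply: eq_bigr => i _.
  pose F k (j : 'I_(p_ k)) := group_coord (t e) j *
    ((-1) ^+ e i * (if k == kappa i then psi k j (x i) i else 0)).
  transitivity (\sum_k \sum_j F k j); last first.
    rewrite sum_group; apply: eq_bigr => s _.
    by rewrite /F /group_coord mxE tagnat.sig2K.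
  rewrite (bigD1 (kappa i))//= [X in _ = _ + X]big1 ?addr0.
    by rewrite mulr_sumr; apply: eq_bigr => j _; rewrite /F eqxx mulrCA.
  move=> k /negbTE ki; rewrite big1// => j _; rewrite /F ki.
  by rewrite !mulr0.
apply: (le_trans (ler_norm _)); apply: (le_trans (ler_norm_sum _ _ _)).
apply: (@le_trans _ _ (l1norm (t e) * A e (q e))); last first.
  by rewrite ler_wpM2r// normr_ge0.
rewrite /l1norm mulr_suml; apply: ler_sum => s _.
by rewrite normrM ler_wpM2l//; exact: qA.
Qed.

(** * The bound for the average over sign vectors *)

Lemma leq_exp2_pred r : (0 < r)%N -> (r <= 2 ^ r.-1)%N.
Proof. by case: r => // r _; exact: ltn_expl. Qed.

(* For the absolute value, [`|y| = Num.max y 0 + Num.max (- y) 0]; selecting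
   [theta0], where the process vanishes, realises the positive parts. *)
Lemma rademacher_symmetrized_process (R : realType) (T : Type) (n r : nat)
    (p_ : 'I_r -> nat) (Thetas : set 'rV[R]_(\sum_(k < r) p_ k))
    (rho : 'rV[R]_(\sum_(k < r) p_ k) -> T -> R)
    (c : 'I_n -> 'rV[R]_(\sum_(k < r) p_ k) -> R)
    (psi : forall k : 'I_r, 'I_(p_ k) -> T -> 'I_n -> R)
    (theta0 : 'rV[R]_(\sum_(k < r) p_ k)) (M : R) (x : 'I_n -> T)
    (t : signs n -> 'rV[R]_(\sum_(k < r) p_ k)) :
  (0 < n)%N -> (0 < r)%N -> (0 < \sum_(k < r) p_ k)%N ->
  Thetas theta0 -> 0 <= M ->
  (forall theta theta', Thetas theta -> Thetas theta' -> forall i,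
     `|(rho theta (x i) - c i theta) - (rho theta' (x i) - c i theta')|
     <= \sum_(k < r) `|\sum_(j < p_ k)
          (group_coord theta j - group_coord theta' j) * psi k j (x i) i|) ->
  (forall e, l1_ball Thetas theta0 M (t e)) ->
  \sum_(e : signs n)
    `|symmetrized_process rho c x (fun i => (-1) ^+ e i) (t e) theta0| <=
  2 ^+ n * (4 * 2 ^+ r.-1 * M *
     Num.sqrt (2 * ln (2 * (\sum_(k < r) p_ k)%:R) / n%:R) *
     max_empirical_norm psi x).
Proof.
move=> n0 r0 p0 T0 M0 lip tS.
set p := (\sum_(k < r) p_ k)%N in Thetas rho c theta0 t T0 lip tS *.
set K := max_empirical_norm psi x.
have n0' : 0 < n%:R :> R by rewrite ltr0n.
pose f (theta : 'rV[R]_p) i :=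
  centered_loss rho c theta (x i) i - centered_loss rho c theta0 (x i) i.
pose u k (theta : 'rV[R]_p) i :=
  \sum_j group_coord (theta - theta0) (k := k) j * psi k j (x i) i.
(* The factor [r] that the contraction attaches to the linear forms turns [M] into [r%:R * M]. *)
pose B := 2 ^+ n * (2 * (r%:R * M) * (Num.sqrt n%:R * K) *
    Num.sqrt (2 * ln (2 * p%:R))).
have S0 : l1_ball Thetas theta0 M theta0.
  by split => //; rewrite subrr /l1norm big1// => i _; rewrite mxE normr0.
have f0 i : f theta0 i = 0 by rewrite /f subrr.
have fB (s : signs n -> 'rV[R]_p) : (forall e, l1_ball Thetas theta0 M (s e)) ->
    \sum_(e : signs n) \sum_i (-1) ^+ e i * f (s e) i <= B.
  apply: (@contraction _ _ _ _ _ f u) => //.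
    move=> a b i [Sa _] [Sb _]; 
    have -> : f a i - f b i = (rho a (x i) - c i a) - (rho b (x i) - c i b).
      by rewrite /f /centered_loss; ring.
    apply: (le_trans (lip _ _ Sa Sb i)); apply: ler_sum => k _.
    rewrite le_eqVlt; apply/orP; left; apply/eqP; congr `|_|.
    rewrite /u -sumrB; apply: eq_bigr => j _.
    by rewrite !group_coordB -mulrBl; congr (_ * _); ring.
  move=> kappa s' Ss'.
  have := @rademacher_dictionary _ _ _ _ _ psi x M kappa
    (fun e => s' e - theta0) n0 p0 M0 (fun e => (Ss' e).2); rewrite -/p -/K.
  move=> /(ler_wpM2l (ler0n _ r)); rewrite mulr_sumr => H.
  apply: (le_trans (le_trans _ H)); last by rewrite /B; lra.
  apply: ler_sum => e _; rewrite mulr_sumr; apply: ler_sum => i _.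
  by rewrite /u mulrCA.
pose g (e : signs n) := \sum_i (-1) ^+ e i * f (t e) i.
pose opp (e : signs n) : signs n := [ffun i => ~~ e i].
have oppK : involutive opp by move=> e; apply/ffunP => i; rewrite !ffunE negbK.
(* [tp] yields the positive part of [g e]; [tn], through the sign reversal [opp], yields the
   negative part of [g (opp e)]. *)
pose tp (e : signs n) := if 0 <= g e then t e else theta0.
pose tn (e : signs n) := if 0 <= g (opp e) then theta0 else t (opp e).
have gE : \sum_(e : signs n) `|g e| =
    \sum_(e : signs n) \sum_i (-1) ^+ e i * f (tp e) i +
    \sum_(e : signs n) \sum_i (-1) ^+ e i * f (tn e) i.
  rewrite [X in _ = _ + X](reindex_inj (inv_inj oppK))/= -big_split /=.
  apply: eq_bigr => e _; rewrite /tp /tn oppK; case: ifPn => [g0|].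
    rewrite ger0_norm// [X in _ + X]big1 ?addr0// => i _.
    by rewrite f0 mulr0.
  rewrite -ltNge => g0; rewrite ltr0_norm// big1 ?add0r; last first.
    by move=> i _; rewrite f0 mulr0.
  rewrite -sumrN; apply: eq_bigr => i _; rewrite ffunE -mulNr; congr (_ * _).
  by case: (e i); rewrite !(expr0, expr1) ?opprK.
have gB : \sum_(e : signs n) `|g e| <= 2 * B.
  rewrite gE mulr_natl mulr2n; apply: lerD; apply: fB => e.
    by rewrite /tp; case: ifP.
  by rewrite /tn; case: ifP.
apply: (@le_trans _ _ (n%:R^-1 * (2 * B))).
  rewrite -(ler_pM2l n0') mulVKf ?gt_eqF// mulr_sumr; apply: le_trans gB.
  apply: ler_sum => e _; rewrite /symmetrized_process normrM.
  by rewrite ger0_norm ?invr_ge0 ?ler0n// mulVKf ?gt_eqF.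
have L0 : 0 <= 2 * ln (2 * p%:R) :> R.
  by rewrite mulr_ge0// ln_ge0// -natrM ler1n muln_gt0.
have nE : n%:R^-1 * Num.sqrt n%:R = (Num.sqrt n%:R)^-1 :> R.
  rewrite -[X in X^-1 * _](sqr_sqrtr (ler0n R n)) expr2 invfM -mulrA.
  by rewrite mulVf ?mulr1// gt_eqF// sqrtr_gt0.
rewrite sqrtrM// sqrtrV ?ler0n// -nE /B.
set s := Num.sqrt (2 * _).
have -> : n%:R^-1 *
      (2 * (2 ^+ n * (2 * (r%:R * M) * (Num.sqrt n%:R * K) * s))) =
    r%:R * (2 ^+ n * (4 * M * (s * (n%:R^-1 * Num.sqrt n%:R)) * K)) by ring.
have -> : 2 ^+ n * (4 * 2 ^+ r.-1 * M * (s * (n%:R^-1 * Num.sqrt n%:R)) * K) =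
    2 ^+ r.-1 * (2 ^+ n * (4 * M * (s * (n%:R^-1 * Num.sqrt n%:R)) * K)).
  by ring.
apply: ler_wpM2r; last by rewrite -natrX ler_nat leq_exp2_pred.
rewrite !mulr_ge0 ?invr_ge0 ?ler0n ?sqrtr_ge0 ?exprn_ge0//.
exact: max_empirical_norm_ge0.
Qed.

(** * Separability and suprema *)

Lemma l1normB_le (R : realType) (p : nat) (a b c : 'rV[R]_p) :
  l1norm (a - b) <= l1norm (a - c) + l1norm (b - c).
Proof.
rewrite /l1norm -big_split /=; apply: ler_sum => i _; rewrite !mxE.
rewrite [`|b _ _ - _|]distrC.
by apply: le_trans (ler_normD _ _); rewrite addrA addrNK.
Qed.

Lemma rat_row_approx (R : realType) (p : nat) (s : 'rV[R]_p) (delta : R) :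
  0 < delta -> exists q : 'rV[rat]_p, l1norm (s - map_mx ratr q) < delta.
Proof.
(* Dividing by [p.+1] keeps the total of [p] errors strictly below [delta] and allows [p = 0]. *)
move=> d0; pose d := delta / p.+1%:R.
have d0' : 0 < d by rewrite divr_gt0.
have qP i : exists q : rat, `|s ord0 i - ratr q| < d.
  have /rat_in_itvoo[q] : s ord0 i - d < s ord0 i + d by lra.
  by rewrite in_itv /= => qd; exists q; rewrite ltr_distlC.
have [q qs] := choice qP.
exists (\row_i q i); apply: (@le_lt_trans _ _ (\sum_(i < p) d)).
  by apply: ler_sum => i _; rewrite !mxE ltW.
rewrite sumr_const card_ord -mulr_natr /d mulrAC ltr_pdivrMr// ltr_pM2l//.
by rewrite ltr_nat.
Qed.

(** Rational points may miss [S], so for each rational centre and each radius 1 / (k + 1) a point of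
    [S] in the ball is chosen, with default [s0] if there is none. Any point of [S] in that ball is
    within 2 / (k + 1) of the chosen one. *)
Lemma l1_separable (R : realType) (p : nat) (S : set 'rV[R]_p)
    (s0 : 'rV[R]_p) : S s0 ->
  exists D : nat -> 'rV[R]_p, (forall m, S (D m)) /\
    forall s delta, S s -> 0 < delta -> exists m, l1norm (s - D m) < delta.
Proof.
move=> Ss0.
pose near (qk : 'rV[rat]_p * nat) :=
  [set s | S s /\ l1norm (s - map_mx ratr qk.1) < qk.2.+1%:R^-1].
exists (fun m => if unpickle m is Some qk then xget s0 (near qk) else s0).
split.
  by move=> m; case: unpickle => // qk; case: xgetP => // s _ [].
move=> s delta Ss d0.
have [k kd] : exists k, k.+1%:R^-1 < delta / 2.
  have [k _ /(_ k (leqnn k))] : \forall k \near \oo, k.+1%:R^-1 < delta / 2.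
    exact: (near_infty_natSinv_lt (PosNum (divr_gt0 d0 (ltr0n _ 2)))).
  by exists k.
have [q qs] := @rat_row_approx _ _ s k.+1%:R^-1 ltac:(by rewrite invr_gt0).
exists (pickle (q, k)); rewrite pickleK.
have [_ qD] : near (q, k) (xget s0 (near (q, k))) by apply: (@xgetI _ s0 _ s).
apply: (le_lt_trans (l1normB_le _ _ (map_mx ratr q))).
rewrite [ltRHS](splitr delta) ltrD//; exact: lt_trans kd.
Qed.

(** [esups _ 0] is the supremum of the sequence from index 0 on; in this form measurability reduces
    to countably many functions. *)
Lemma ereal_sup_dense (R : realType) (V : Type) (S : set V) (D : nat -> V)
    (h : V -> R) : (forall m, S (D m)) ->
  (forall s delta, S s -> 0 < delta -> exists m, h s <= h (D m) + delta) ->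
  ereal_sup [set (h v)%:E | v in S] = esups (fun m => (h (D m))%:E) 0.
Proof.
move=> DS hD; apply/eqP; rewrite eq_le; apply/andP; split.
  apply: ge_ereal_sup => _ [s Ss <-]; apply/lee_addgt0Pr => d d0.
  have [m hm] := hD s d Ss d0.
  apply: (@le_trans _ _ (h (D m) + d)%:E); first by rewrite lee_fin.
  rewrite EFinD leeD2r//; apply: ereal_sup_ubound.
  by exists m => //=.
apply: ge_ereal_sup => _ [m _ <-]; apply: ereal_sup_ubound.
by exists (D m).
Qed.

(** Near-maximisers chosen separately for each [i] make up a selection [t]. Constant selections and
    non-negativity first show that each supremum is finite. *)
Lemma sum_ereal_sup_le (R : realType) (I : finType) (V : Type) (S : set V)
    (s0 : V) (h : I -> V -> R) (B : R) : S s0 -> (forall i v, 0 <= h i v) ->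
  (forall t : I -> V, (forall i, S (t i)) -> \sum_i h i (t i) <= B) ->
  (\sum_i ereal_sup [set (h i v)%:E | v in S] <= B%:E)%E.
Proof.
move=> Ss0 h0 hB.
have sfin i : ereal_sup [set (h i v)%:E | v in S] \is a fin_num.
  rewrite ge0_fin_numE; last first.
    by apply: ereal_sup_ge; exists (h i s0)%:E; [exists s0|rewrite lee_fin].
  apply: (@le_lt_trans _ _ B%:E); last exact: ltry.
  apply: ge_ereal_sup => _ [v Sv <-]; rewrite lee_fin.
  apply: le_trans (hB (fun=> v) (fun=> Sv)).
  by rewrite (bigD1 i)//= lerDl sumr_ge0.
apply/lee_addgt0Pr => d d0; pose d' := d / #|I|.+1%:R.
have d0' : 0 < d' by rewrite divr_gt0.
have tP i : exists v, S v /\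
    (ereal_sup [set (h i v)%:E | v in S] <= (h i v + d')%:E)%E.
  have [_ [v Sv <-] hv] := ub_ereal_sup_adherent d0' (sfin i).
  by exists v; split => //; rewrite EFinD -leeBlDr// ltW.
have [t tS] := choice tP.
apply: (@le_trans _ _ (\sum_i (h i (t i) + d'))%:E).
  by rewrite -sumEFin; apply: lee_sum => i _; exact: (tS i).2.
rewrite -EFinD lee_fin big_split /= lerD ?hB//.
  by move=> i; exact: (tS i).1.
rewrite sumr_const -mulr_natr /d' mulrAC ler_pdivrMr// ler_pM2l//.
by rewrite ler_nat cardE.
Qed.

(** Each coordinate difference is at most the l1 distance. The Lipschitz constant depends on [x] and
    [e] but not on the parameters, so a dense set of parameters determines the supremum. *)
Lemma symmetrized_process_lipschitz (R : realType) (T : Type) (n r : nat)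
    (p_ : 'I_r -> nat) (rho : 'rV[R]_(\sum_(k < r) p_ k) -> T -> R)
    (c : 'I_n -> 'rV[R]_(\sum_(k < r) p_ k) -> R)
    (psi : forall k : 'I_r, 'I_(p_ k) -> T -> 'I_n -> R)
    (theta0 theta theta' : 'rV[R]_(\sum_(k < r) p_ k)) (x : 'I_n -> T)
    (e : 'I_n -> R) :
  (forall i,
     `|(rho theta (x i) - c i theta) - (rho theta' (x i) - c i theta')|
     <= \sum_(k < r) `|\sum_(j < p_ k)
          (group_coord theta j - group_coord theta' j) * psi k j (x i) i|) ->
  `|symmetrized_process rho c x e theta theta0| <=
  `|symmetrized_process rho c x e theta' theta0| +
  l1norm (theta - theta') *
    (n%:R^-1 * \sum_i `|e i| * \sum_k \sum_j `|psi k j (x i) i|).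
Proof.
move=> lip; rewrite -lerBlDl; apply: (le_trans (lerB_dist _ _)).
rewrite /symmetrized_process -mulrBr normrM ger0_norm ?invr_ge0 ?ler0n//.
rewrite mulrCA ler_wpM2l ?invr_ge0 ?ler0n// -sumrB mulr_sumr.
apply: (le_trans (ler_norm_sum _ _ _)); apply: ler_sum => i _.
rewrite -mulrBr normrM mulrCA ler_wpM2l//.
rewrite [X in `|X|](_ : _ =
    (rho theta (x i) - c i theta) -
    (rho theta' (x i) - c i theta')); last first.
  by rewrite /centered_loss; ring.
apply: (le_trans (lip i)); rewrite mulr_sumr; apply: ler_sum => k _.
apply: (le_trans (ler_norm_sum _ _ _)); rewrite mulr_sumr.
apply: ler_sum => j _; rewrite normrM ler_wpM2r//.
rewrite -group_coordB l1normE [leRHS](bigD1 k)//=.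
rewrite (bigD1 j)//= -addrA lerDl addr_ge0 ?sumr_ge0//.
by move=> *; rewrite sumr_ge0.
Qed.

(** * Independence and versions of conditional expectations *)

(** [A] splits into its part outside [B], null for the restricted measure, and its part inside [B],
    where the restricted measure agrees with [mu]. *)
Lemma integral_mrestr_setI d (T : measurableType d) (R : realType)
    (mu : {measure set T -> \bar R}) (A B : set T) (mB : measurable B)
    (f : T -> \bar R) : measurable A -> measurable_fun A f ->
  (forall x, A x -> 0 <= f x)%E ->
  (\int[mrestr mu mB]_(x in A) f x = \int[mu]_(x in A `&` B) f x)%E.
Proof.
move=> mA mf f0; rewrite -{1}(setUIDK A B) ge0_integral_setU; first last.
- rewrite disj_set2E; apply/eqP.
  by rewrite -subset0 => x [[_ Bx] [_ /(_ Bx)]].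
- by rewrite setUIDK.
- by rewrite setUIDK.
- exact: measurableD.
- exact: measurableI.
rewrite [X in (_ + X)%E](eq_measure_integral mzero) ?integral_measure_zero
  ?adde0; last first.
  move=> C mC CAB; rewrite /= /mrestr (_ : C `&` B = set0) ?measure0//.
  by rewrite -subset0 => x [/CAB[]].
apply: eq_measure_integral => C mC CAB.
by rewrite /= /mrestr setIidl// => x /CAB[].
Qed.

(* Both sides are integrals over the sigma-algebra generated by [G], on which
   the measures [P (_ `&` B)] and [p * P] coincide. *)
Lemma integral_setI_independent d (W : measurableType d) (R : realType)
    (P : probability W R) (G : set (set W)) (A B : set W)
    (p : {nonneg R}) (f : g_sigma_algebraType G -> \bar R) :
  <<s G >> `<=` measurable -> measurable B ->
  (forall C, <<s G >> C -> P (C `&` B) = p%:num%:E * P C)%E ->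
  <<s G >> A -> measurable_fun setT f -> (forall x, 0 <= f x)%E ->
  (\int[P]_(x in A `&` B) f x = p%:num%:E * \int[P]_(x in A) f x)%E.
Proof.
move=> GW mB PB GA mf f0.
have mA : measurable A by exact: GW.
(* The identity, seen as a map into [W] with the smaller sigma-algebra; pushing a measure forward
   along it restricts the measure to that sigma-algebra. *)
pose phi : W -> g_sigma_algebraType G := id.
have mphi : measurable_fun setT phi.
  by move=> _ C mC; rewrite setTI; exact: GW.
have mfW : measurable_fun setT (f : W -> \bar R).
  exact: (measurableT_comp mf mphi).
have mfA : measurable_fun A f by exact: measurable_funTS.
have mfA' : @measurable_fun _ _ (g_sigma_algebraType G) _ A f.
  exact: measurable_funTS.
rewrite -(@integral_mrestr_setI _ _ _ P A B mB)//.
rewrite -ge0_integral_mscale//.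
have push (mu : {measure set W -> \bar R}) :
    (\int[mu]_(x in A) f x = \int[pushforward mu phi]_(x in A) f x)%E.
  by rewrite [RHS](ge0_integral_pushforward mphi).
rewrite !push.
by apply: eq_measure_integral => // C mC _; exact: PB.
Qed.

Lemma g_sigma_measurable_fun (W : pointedType) (R : realType)
    (G : set (set W)) (Z : W -> \bar R) :
  (forall B : set (\bar R), measurable B -> <<s G >> (Z @^-1` B)) <->
  measurable_fun [set: g_sigma_algebraType G] (Z : g_sigma_algebraType G -> _).
Proof.
split=> [GZ _ B mB|mZ B mB]; first by rewrite setTI; exact: GZ.
by have := mZ measurableT B mB; rewrite setTI.
Qed.

Lemma g_sigma_measurable_funW d (W : measurableType d) (R : realType)
    (G : set (set W)) (Z : W -> \bar R) : <<s G >> `<=` measurable ->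
  measurable_fun [set: g_sigma_algebraType G]
    (Z : g_sigma_algebraType G -> _) ->
  measurable_fun [set: W] Z.
Proof.
move=> GW mZ _ B mB; rewrite setTI; apply: GW.
exact: (g_sigma_measurable_fun G Z).2.
Qed.

(** On [N m], [Z] is at most [m] and [Z'] exceeds it by at least 1 / (m + 1). The integrals of [Z]
    and [Z'] over [N m] agree and are finite, so [N m] is null; these sets cover the points where Z
    < Z'. *)
Lemma is_cond_expectation_ae_le d (W : measurableType d) (R : realType)
    (P : probability W R) (G : set (set W)) (Y Z Z' : W -> \bar R) :
  <<s G >> `<=` measurable -> (forall w, Z w < +oo)%E ->
  is_cond_expectation P <<s G >> Y Z -> is_cond_expectation P <<s G >> Y Z' ->
  {ae P, forall w, (Z' w <= Z w)%E}.
Proof.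
move=> GW Zoo [_ Z0 GZ YZ] [_ Z'0 GZ' YZ'].
have mZ := (g_sigma_measurable_fun G Z).1 GZ.
have mZ' := (g_sigma_measurable_fun G Z').1 GZ'.
have mZW := g_sigma_measurable_funW GW mZ.
have mZ'W := g_sigma_measurable_funW GW mZ'.
pose c m : R := m.+1%:R^-1.
have c0 m : 0 < c m by rewrite invr_gt0.
pose N m := [set w | (Z w <= m%:R%:E)%E] `&`
  [set w | (Z w + (c m)%:E <= Z' w)%E].
have GN m : <<s G >> (N m).
  have mT : measurable [set: g_sigma_algebraType G] by [].
  have := emeasurable_fun_infty_c mT mZ m%:R%:E; rewrite setTI => m1.
  have mZc : measurable_fun [set: g_sigma_algebraType G]
      (fun w : g_sigma_algebraType G => (Z w + (c m)%:E)%E).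
    by apply: emeasurable_funD => //; exact: measurable_cst.
  have := measurable_lee mT mZc mZ'; rewrite setTI => m2.
  exact: (measurableI _ _ m1 m2).
have mN m : measurable (N m) by exact: GW.
have PN m : P (N m) = 0%E.
  have ZN : (\int[P]_(w in N m) Z w \is a fin_num)%E.
    rewrite ge0_fin_numE; last by apply: integral_ge0 => w _; exact: Z0.
    apply: (@le_lt_trans _ _ (\int[P]_(w in N m) (cst m%:R%:E) w)%E).
      apply: ge0_le_integral => //; last by move=> w [].
      exact: measurable_funTS.
    rewrite integral_cst//= -ge0_fin_numE ?mule_ge0// fin_numM//.
    exact: fin_num_measure.
  have : (\int[P]_(w in N m) (Z w + (c m)%:E) <= \int[P]_(w in N m) Z' w)%E.
    apply: ge0_le_integral => //.
    - by move=> w _; rewrite adde_ge0// lee_fin ltW.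
    - apply: emeasurable_funD; last exact: measurable_cst.
      exact: measurable_funTS.
    - exact: measurable_funTS.
    - by move=> w [].
  rewrite ge0_integralD//; first last.
  - by move=> w _; rewrite lee_fin ltW.
  - exact: measurable_funTS.
  rewrite YZ'// -YZ// integral_cst// -[leRHS]adde0 leeD2lE//.
  rewrite pmule_rle0 ?lte_fin// => P0.
  by apply/eqP; rewrite eq_le P0 measure_ge0.
suff : P.-negligible (~` [set w | (Z' w <= Z w)%E]) by [].
apply: (@negligibleS _ _ _ _ (\bigcup_m N m)); last first.
  apply: negligible_bigcup => m; exists (N m); split => //.
  exact: PN.
move=> w /= /negP; rewrite -ltNge => ZZ'.
have Zfin : Z w \is a fin_num by rewrite ge0_fin_numE.
have [m [Zm mZ'm]] : exists m : nat,
    fine (Z w) <= m%:R /\ (Z w + (c m)%:E <= Z' w)%E.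
  (* A positive gap exists also where [Z'] is infinite; there 1 will do. *)
  have : exists2 delta : R, 0 < delta & (Z w + delta%:E <= Z' w)%E.
    case: (Z' w) ZZ' => [r| |] //.
      rewrite -{1}(fineK Zfin) lte_fin => Zr; exists (r - fine (Z w)).
        by rewrite subr_gt0.
      by rewrite -{1}(fineK Zfin) -EFinD addrC subrK.
    by exists 1; rewrite ?leey.
    by rewrite ltNge leNye.
  case=> delta d0 Zd.
  have [m [Zm md]] := filter_ex (filterI (nbhs_infty_ger (fine (Z w)))
    (near_infty_natSinv_lt (PosNum d0))).
  exists m; split; first exact: Zm.
  apply: le_trans Zd.
  by rewrite leeD2l// lee_fin ltW.
by exists m => //; split => //=; rewrite -(fineK Zfin) lee_fin.
Qed.

(** On [B i], [Y] is the [<<s G>>]-measurable [g i], and independence turns its integral over the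
    part of [A] in [B i] into [p] times its integral over [A]. The [B i] are disjoint of total mass
    1, so they exhaust [W] up to a null set. *)
Lemma is_cond_expectation_discrete d (W : measurableType d) (R : realType)
    (P : probability W R) (G : set (set W)) (I : finType) (B : I -> set W)
    (p : {nonneg R}) (Y : W -> \bar R) (g : I -> W -> \bar R) :
  <<s G >> `<=` measurable -> measurable_fun setT Y -> (forall w, 0 <= Y w)%E ->
  (forall i, measurable (B i)) -> trivIset setT B ->
  #|I|%:R * p%:num = 1 ->
  (forall i C, <<s G >> C -> P (C `&` B i) = p%:num%:E * P C)%E ->
  (forall i, measurable_fun [set: g_sigma_algebraType G]
     (g i : g_sigma_algebraType G -> _)) ->
  (forall i w, 0 <= g i w)%E ->
  (forall i w, B i w -> Y w = g i w) ->
  is_cond_expectation P <<s G >> Y (fun w => \sum_i p%:num%:E * g i w)%E.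
Proof.
move=> GW mY Y0 mB tB Ip PB mg g0 Yg.
have mgW i := g_sigma_measurable_funW GW (mg i).
split => //.
- by move=> w; rewrite sume_ge0// => i _; rewrite mule_ge0 ?lee_fin.
- apply/g_sigma_measurable_fun; apply: emeasurable_sum => i.
  by apply: emeasurable_funM => //; exact: measurable_cst.
move=> A GA; have mA := GW _ GA.
rewrite ge0_integral_sum//; first last.
- by move=> i w _; rewrite mule_ge0 ?lee_fin.
- move=> i; apply: emeasurable_funM; first exact: measurable_cst.
  exact: measurable_funTS.
pose U := \big[setU/set0]_(i <- index_enum I) B i.
have mU : measurable U by exact: bigsetU_measurable.
have UE : U = \bigcup_i B i.
  rewrite /U -bigcup_seq; apply: eq_bigcupl.
  by split => i //= _; rewrite mem_index_enum.
have PBi i : P (B i) = p%:num%:E.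
  rewrite -[B i]setTI PB ?probability_setT ?mule1//.
  exact: (@measurableT _ (g_sigma_algebraType G)).
have PU : P (~` U) = 0%E.
  rewrite probability_setC// -[P U]mul1e -integral_cst//.
  rewrite ge0_integral_bigsetU//; last 2 first.
  - exact: index_enum_uniq.
  - exact: sub_trivIset tB.
  rewrite (eq_bigr (fun=> p%:num%:E)) => [|i _]; last first.
    by rewrite integral_cst// mul1e; exact: PBi.
  by rewrite sumEFin sumr_const -mulr_natl Ip subee.
rewrite (@ge0_negligible_integral _ _ _ _ _ (~` U))//; last 2 first.
- exact: measurableC.
- exact: measurable_funTS.
rewrite setDE setCK UE setI_bigcupr.
have -> : \bigcup_i (A `&` B i) =
    \big[setU/set0]_(i <- index_enum I) (A `&` B i).
  rewrite -bigcup_seq; apply: eq_bigcupl.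
  by split => i //= _; rewrite mem_index_enum.
rewrite ge0_integral_bigsetU//; first last.
- exact: measurable_funTS.
- by move=> i j _ _ [w [[_ Bi] [_ Bj]]]; apply: tB => //; exists w.
- exact: index_enum_uniq.
- by move=> i; exact: measurableI.
apply: eq_bigr => i _.
have -> : (\int[P]_(w in A `&` B i) Y w = \int[P]_(w in A `&` B i) g i w)%E.
  by apply: eq_integral => w /set_mem[_ Bw]; exact: Yg.
rewrite (@integral_setI_independent _ _ _ _ G _ _ p)//; last exact: PB.
rewrite ge0_integralZl//; exact: measurable_funTS.
Qed.

(** * Measurability of the suprema *)

(** The space and the sign functions are general, to cover both [W] with the random signs and [W]
    under the sigma-algebra generated by [X] with fixed signs. *)
Lemma measurable_sup_symmetrized_process d d' (W : measurableType d)
    (T : measurableType d') (R : realType) (n r : nat) (p_ : 'I_r -> nat)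
    (X : 'I_n -> W -> T) (eps : 'I_n -> W -> R)
    (Thetas : set 'rV[R]_(\sum_(k < r) p_ k))
    (rho : 'rV[R]_(\sum_(k < r) p_ k) -> T -> R)
    (c : 'I_n -> 'rV[R]_(\sum_(k < r) p_ k) -> R)
    (psi : forall k : 'I_r, 'I_(p_ k) -> T -> 'I_n -> R)
    (theta0 : 'rV[R]_(\sum_(k < r) p_ k)) (M : R) :
  (forall i, measurable_fun setT (X i)) ->
  (forall i, measurable_fun setT (eps i)) ->
  (forall theta, Thetas theta -> measurable_fun setT (rho theta)) ->
  l1_ball Thetas theta0 M theta0 ->
  (forall theta theta', Thetas theta -> Thetas theta' ->
     forall (i : 'I_n) (w : W),
     `|(rho theta (X i w) - c i theta) - (rho theta' (X i w) - c i theta')|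
     <= \sum_(k < r) `|\sum_(j < p_ k)
          (group_coord theta j - group_coord theta' j) * psi k j (X i w) i|) ->
  measurable_fun setT (fun w => ereal_sup
    [set (`|symmetrized_process rho c (fun i => X i w) (fun i => eps i w)
              theta theta0|)%:E
    | theta in l1_ball Thetas theta0 M]).
Proof.
move=> mX meps mrho S0 lip.
have [D [DS Ddense]] := l1_separable S0.
pose Y w theta := `|symmetrized_process rho c (fun i => X i w)
  (fun i => eps i w) theta theta0|.
rewrite (_ : (fun w => _) = fun w => esups (fun m => (Y w (D m))%:E) 0).
  apply: (@measurable_fun_esups _ _ _ setT (fun m w => (Y w (D m))%:E)) => m.
  apply/measurable_EFinP; apply: measurableT_comp => //.
  apply: measurable_funM => //; apply: measurable_sum => i.
  have mloss theta : Thetas theta ->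
      measurable_fun setT (fun w => centered_loss rho c theta (X i w) i).
    move=> Ttheta; apply: measurable_funB => //.
    by apply: measurableT_comp => //; exact: mrho.
  apply: measurable_funM => //; apply: measurable_funB; apply: mloss.
    exact: (DS m).1.
  exact: S0.1.
apply/funext => w; apply: ereal_sup_dense => // s delta Ss delta0.
pose L := n%:R^-1 * \sum_i `|eps i w| * \sum_k \sum_j `|psi k j (X i w) i|.
have L0 : 0 <= L.
  rewrite mulr_ge0 ?invr_ge0 ?ler0n// sumr_ge0// => i _; rewrite mulr_ge0//.
  by rewrite sumr_ge0// => k _; rewrite sumr_ge0.
(* [L] may vanish, hence the denominator [L + 1] below. *)
have L1 : 0 < L + 1 by rewrite ltr_wpDl.
have [m sm] := Ddense s (delta / (L + 1)) Ss (divr_gt0 delta0 L1).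
exists m.
have lipw i := lip _ _ Ss.1 (DS m).1 i w.
apply: (le_trans (symmetrized_process_lipschitz _ _ lipw)).
rewrite lerD2l -/L; move: sm; rewrite ltr_pdivlMr// => /ltW; apply: le_trans.
by rewrite ler_wpM2l ?lerDl//; apply: sumr_ge0.
Qed.

Lemma measurable_g_sigma_preimage d d' (W : measurableType d)
    (T : measurableType d') (n : nat) (X : 'I_n -> W -> T) (i : 'I_n) :
  measurable_fun [set: g_sigma_algebraType (\big[setU/set0]_(i < n)
    preimage_set_system setT (X i) measurable)] (X i).
Proof.
move=> _ B mB; apply: sub_sigma_algebra.
rewrite -bigcup_seq; exists i; first exact: mem_index_enum.
by exists B.
Qed.

Lemma g_sigma_preimage_measurable d d' (W : measurableType d)
    (T : measurableType d') (n : nat) (X : 'I_n -> W -> T) :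
  (forall i, measurable_fun setT (X i)) ->
  g_sigma_preimage X `<=` measurable.
Proof.
move=> mX; apply: smallest_sub; first exact: sigma_algebra_measurable.
by rewrite -bigcup_seq => A [i _ [B mB <-]]; exact: mX.
Qed.

(** * The conditional bound *)

Theorem theorem4p2 (R : realType) :
  exists C : R,
  forall (d d' : measure_display)
    (W : measurableType d) (T : measurableType d') (P : probability W R)
    (n : nat) (X : 'I_n -> {RV P >-> T}) (eps : 'I_n -> {RV P >-> R})
    (r : nat) (p_ : 'I_r -> nat)
    (Theta Thetas : set 'rV[R]_(\sum_(k < r) p_ k))
    (rho : 'rV[R]_(\sum_(k < r) p_ k) -> T -> R)
    (c : 'I_n -> 'rV[R]_(\sum_(k < r) p_ k) -> R)
    (psi : forall k : 'I_r, 'I_(p_ k) -> T -> 'I_n -> R)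
    (theta0 : 'rV[R]_(\sum_(k < r) p_ k)) (M : R),
  (0 < n)%N -> (0 < r)%N -> (0 < \sum_(k < r) p_ k)%N ->
  mutually_independent P (fun i => X i : W -> T) ->
  rademacher_sequence eps ->
  independent_classes P (g_sigma_preimage (fun i => X i : W -> T))
                        (g_sigma_preimage (fun i => eps i : W -> R)) ->
  Thetas = Theta \/ Thetas = convex_hull Theta ->
  (forall theta, Thetas theta -> measurable_fun setT (rho theta)) ->
  Theta theta0 ->
  0 < M ->
  (forall (k : 'I_r) (j : 'I_(p_ k)) (x : T) (i : 'I_n), 0 <= psi k j x i) ->
  (forall theta theta', Thetas theta -> Thetas theta' ->
     forall (i : 'I_n) (w : W),
     `|(rho theta (X i w) - c i theta) - (rho theta' (X i w) - c i theta')|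
     <= \sum_(k < r) `|\sum_(j < p_ k)
          (group_coord theta j - group_coord theta' j) * psi k j (X i w) i|) ->
  {ae P, forall w,
    (cond_expectation P (g_sigma_preimage (fun i => X i : W -> T))
       (fun w => ereal_sup
          [set (`|symmetrized_process rho c (fun i => X i w) (fun i => eps i w)
                    theta theta0|)%:E
          | theta in l1_ball Thetas theta0 M]) w
     <= (C * 2 ^+ r.-1 * M
          * Num.sqrt (2 * ln (2 * (\sum_(k < r) p_ k)%:R) / n%:R)
          * max_empirical_norm psi (fun i => X i w))%:E)%E}.
Proof.
(* 4 is 2 from the maximal inequality times 2 from splitting the absolute value into positive and
   negative parts. *)
exists 4 => d d' W T P n X eps r p_ Theta Thetas rho c psi theta0 M.
move=> n0 r0 p0 _ [eps_ind eps1 epsN1] Xeps TE mrho Theta0 M0 _ lip.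
have Thetas0 : Thetas theta0.
  by case: TE => -> //; apply: sub_gen_smallest.
have S0 : l1_ball Thetas theta0 M theta0.
  by split => //; rewrite subrr /l1norm big1 ?ltW// => i _; rewrite mxE normr0.
set G := \big[setU/set0]_(i < n)
  preimage_set_system setT (X i : W -> T) measurable.
have GE : g_sigma_preimage (fun i => X i : W -> T) = <<s G >> by [].
have GW : <<s G >> `<=` measurable by exact: g_sigma_preimage_measurable.
set Y := fun w : W => ereal_sup _.
(* The event that the sign vector is [e]; by independence each of these [2 ^ n] disjoint events has
   mass [(2 ^+ n)^-1]. *)
pose B (e : signs n) := \bigcap_(i in [set i | i \in [set: 'I_n]%SET])
  (eps i : W -> R) @^-1` [set (-1) ^+ e i].
have Beps e : g_sigma_preimage (fun i => eps i : W -> R) (B e).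
  apply: (@fin_bigcap_measurable _ (g_sigma_algebraType (\big[setU/set0]_(i < n)
    preimage_set_system setT (eps i : W -> R) measurable))) => // i _.
  rewrite -[X in measurable X]setTI; apply: measurable_g_sigma_preimage => //.
have mB e : measurable (B e).
  by apply: (g_sigma_preimage_measurable _ (Beps e)).
have p2 : 0 <= (2 ^+ n)^-1 :> R by rewrite invr_ge0 exprn_ge0.
have PB e : P (B e) = ((2 ^+ n)^-1)%:E.
  rewrite eps_ind// -exprVn -[n in RHS]card_ord -prodr_const -prodEFin.
  apply: eq_big => [i|i _]; first by rewrite inE.
  by case: (e i); rewrite ?expr1 ?expr0.
pose g (e : signs n) (w : W) := ereal_sup
  [set (`|symmetrized_process rho c (fun i => X i w) (fun i => (-1) ^+ e i)
          theta theta0|)%:E | theta in l1_ball Thetas theta0 M].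
have sup_ge0 (h : 'rV[R]_(\sum_(k < r) p_ k) -> R) :
    (0 <= ereal_sup [set (`|h theta|)%:E | theta in l1_ball Thetas theta0 M])%E.
  apply: ereal_sup_ge; exists (`|h theta0|)%:E; first by exists theta0.
  by rewrite lee_fin.
(* The candidate version: the average over fixed sign vectors, which depends on [w] only through
   [X]. *)
pose Z w := (\sum_(e : signs n) (NngNum p2)%:num%:E * g e w)%E.
have YZ : is_cond_expectation P <<s G >> Y Z.
  apply: (is_cond_expectation_discrete (B := B)) => //.
  - exact: measurable_sup_symmetrized_process lip.
  - by move=> w; exact: sup_ge0.
  - move=> e e' _ _ [w [Be Be']]; apply/ffunP => i.
    have := Be i; have := Be' i; rewrite /= inE => /(_ isT) -> /(_ isT)/eqP.
    by rewrite (inj_eq (@signr_inj _)) => /eqP.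
  - by rewrite card_ffun card_bool card_ord natrX/= divff.
  - by move=> e C GC; rewrite Xeps// PB muleC.
  - move=> e; apply: (@measurable_sup_symmetrized_process _ _
      (g_sigma_algebraType G) T R n r p_ (fun i => X i : W -> T)
      (fun i _ => (-1) ^+ e i) Thetas rho c psi theta0 M) => // i.
    exact: measurable_g_sigma_preimage.
  - by move=> e w; exact: sup_ge0.
  - move=> e w Be; rewrite /Y /g.
    suff -> : (fun i => eps i w) = (fun i => (-1) ^+ e i) by [].
    by apply/funext => i; apply: Be; rewrite /= inE.
have Zle w : (Z w <= (4 * 2 ^+ r.-1 * M *
    Num.sqrt (2 * ln (2 * (\sum_(k < r) p_ k)%:R) / n%:R) *
    max_empirical_norm psi (fun i => X i w))%:E)%E.
  rewrite /Z -ge0_sume_distrr; last by move=> e _; exact: sup_ge0.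
  rewrite lee_pdivrMl ?exprn_gt0//.
  rewrite -EFinM; apply: sum_ereal_sup_le S0 _ _ => // t tS.
  apply: (rademacher_symmetrized_process n0 r0 p0 Thetas0 (ltW M0) _ tS).
  by move=> theta theta' Tt Tt' i; exact: lip.
rewrite GE /cond_expectation.
(* As [Z] is a version, the default [+oo] is ruled out and the chosen [Z'] is a version as well. *)
case: xgetP => [Z' _ YZ'|/(_ Z)//].
apply: filterS (is_cond_expectation_ae_le GW _ YZ YZ') => [w Z'Z|w].
  exact: le_trans (Zle w).
by apply: le_lt_trans (Zle w) (ltry _).
Qed.
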